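(* Let $\mathfrak{L}$ be a left Leibniz algebra over a field $\mathbb{F}$, and let $M$ and $N$ be $\mathfrak{L}$-bimodules. Endow the vector space $M\otimes N$ with the left and right $\mathfrak{L}$-actions $$x\cdot(m\otimes n):=(x\cdot m)\otimes n+m\otimes(x\cdot n),\qquad (m\otimes n)\cdot x:=(m\cdot x)\otimes n+m\otimes(n\cdot x)$$ for $x\in\mathfrak{L}$, $m\in M$, $n\in N$. Then $M\otimes N$ satisfies (LLM) and (LML). Furthermore, (MLL) holds for $M\otimes N$ if, and only if, $$(x\cdot m+m\cdot x)\otimes(n\cdot y)+(m\cdot y)\otimes(x\cdot n+n\cdot x)=0$$ for all $x,y\in\mathfrak{L}$, $m\in M$, $n\in N$. In particular, if $M$ and $N$ are both symmetric or both anti-symmetric, then $M\otimes N$ is a symmetric or anti-symmetric $\mathfrak{L}$-bimodule, respectively.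
   Context: Tensor products are over the ground field $\mathbb{F}$ (arbitrary). A left Leibniz algebra is an $\mathbb{F}$-vector space $\mathfrak{L}$ with a bilinear multiplication satisfying $x(yz)=(xy)z+y(xz)$ for all $x,y,z\in\mathfrak{L}$. For a vector space $M$ with bilinear left and right $\mathfrak{L}$-actions consider the conditions, for all $x,y\in\mathfrak{L}$, $m\in M$: (LLM) $(xy)\cdot m=x\cdot(y\cdot m)-y\cdot(x\cdot m)$; (LML) $(x\cdot m)\cdot y=x\cdot(m\cdot y)-m\cdot(xy)$; (MLL) $(m\cdot x)\cdot y=m\cdot(xy)-x\cdot(m\cdot y)$. An $\mathfrak{L}$-bimodule is such an $M$ satisfying (LLM), (LML) and (MLL). It is symmetric if $m\cdot x=-x\cdot m$ for all $x\in\mathfrak{L}$, $m\in M$, and anti-symmetric if $m\cdot x=0$ for all $x\in\mathfrak{L}$, $m\in M$. *)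

(* Defs.v *)
From HB Require Import structures.
From mathcomp Require Import all_boot all_order all_algebra finmap.
From mathcomp.classical Require boolp.
From mathcomp.multinomials Require Import monalg.

Set Implicit Arguments.
Unset Strict Implicit.
Unset Printing Implicit Defensive.

Import GRing.Theory.
Local Open Scope ring_scope.

Reserved Notation "x \** y" (at level 40, left associativity).
Reserved Notation "x \*> m" (at level 40, left associativity).
Reserved Notation "m \<* x" (at level 40, left associativity).
Reserved Notation "m \ox n" (at level 40, left associativity).

(* [tens M N] is the free vector space [{malg F[M * N]}] on the set M * N
   modulo the subspace spanned by the bilinearity relations.  No finiteness
   is assumed on M and N, hence membership in this subspace is turned into a
   boolean classically ([boolp.asbool]). *)
Section Tensor.
Variables (F : fieldType) (M N : lmodType F).
Implicit Types (a : F) (m : M) (n : N).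

Definition free_pair m n : {malg F[(M * N)%type]} :=
  mkmalgU (m, n)%core 1.

Inductive tens_span : {malg F[(M * N)%type]} -> Prop :=
| tens_span_l a m m' n :
    tens_span (free_pair (a *: m + m') n - (a *: free_pair m n + free_pair m' n))
| tens_span_r a m n n' :
    tens_span (free_pair m (a *: n + n') - (a *: free_pair m n + free_pair m n'))
| tens_span_0 : tens_span 0
| tens_span_linear a u v :
    tens_span u -> tens_span v -> tens_span (a *: u + v).

Definition tens_rel (u : {malg F[(M * N)%type]}) : bool :=
  boolp.asbool (tens_span u).

Lemma tens_relP u : reflect (tens_span u) (tens_rel u).
Proof. exact: boolp.asboolP. Qed.

Lemma tens_rel_zmod_closed : zmod_closed tens_rel.
Proof.
split; first by apply/tens_relP; exact: tens_span_0.
move=> u v /tens_relP su /tens_relP sv; apply/tens_relP.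
by rewrite addrC -scaleN1r; apply: tens_span_linear.
Qed.

HB.instance Definition _ :=
  GRing.isZmodClosed.Build _ tens_rel tens_rel_zmod_closed.

Definition tens_zmod_rel : zmodClosed {malg F[(M * N)%type]} :=
  GRing.ZmodClosed.clone _ tens_rel _.

Definition tens : Type := Quotient.quot tens_zmod_rel.
HB.instance Definition _ := GRing.Zmodule.on tens.

Definition tens_pi (u : {malg F[(M * N)%type]}) : tens :=
  \pi_(Quotient.quot tens_zmod_rel)%qT u.

Lemma tens_pi_eq u v : tens_pi u = tens_pi v <-> tens_span (u - v).
Proof.
split=> [e|/tens_relP uv].
  apply/tens_relP; rewrite -[tens_rel _]/(_ \in tens_zmod_rel).
  by rewrite Quotient.idealrBE; apply/eqP.
by apply/eqP; rewrite -Quotient.idealrBE.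
Qed.

Lemma tens_pi_repr (t : tens) :
  tens_pi (repr (t : Quotient.quot tens_zmod_rel)) = t.
Proof. exact: reprK. Qed.

Lemma tens_piB : zmod_morphism tens_pi.
Proof. exact: (raddfB (\pi_(Quotient.quot tens_zmod_rel)%qT)). Qed.
HB.instance Definition _ := GRing.isZmodMorphism.Build _ _ tens_pi tens_piB.

Definition tens_scale a (t : tens) : tens :=
  tens_pi (a *: repr (t : Quotient.quot tens_zmod_rel)).

Lemma tens_scale_pi a u : tens_scale a (tens_pi u) = tens_pi (a *: u).
Proof.
apply/tens_pi_eq; rewrite -scalerBr -[_ *: _]addr0.
by apply: tens_span_linear tens_span_0; apply/tens_pi_eq; rewrite tens_pi_repr.
Qed.

Fact tens_scaleA a b t : tens_scale a (tens_scale b t) = tens_scale (a * b) t.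
Proof. by rewrite -[t]tens_pi_repr !tens_scale_pi scalerA. Qed.
Fact tens_scale1 : left_id 1 tens_scale.
Proof. by move=> t; rewrite -[t]tens_pi_repr tens_scale_pi scale1r. Qed.
Fact tens_scaleDr : right_distributive tens_scale +%R.
Proof.
move=> a s t; rewrite -[s]tens_pi_repr -[t]tens_pi_repr.
by rewrite -raddfD !tens_scale_pi scalerDr raddfD.
Qed.
Fact tens_scaleDl t : {morph tens_scale^~ t : a b / a + b}.
Proof.
move=> a b; rewrite -[t]tens_pi_repr.
by rewrite !tens_scale_pi scalerDl raddfD.
Qed.
HB.instance Definition _ := GRing.Zmodule_isLmodule.Build F tens
  tens_scaleA tens_scale1 tens_scaleDr tens_scaleDl.

Lemma tens_piZ : scalable tens_pi.
Proof. by move=> a u; rewrite -tens_scale_pi. Qed.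
HB.instance Definition _ := GRing.isScalable.Build F _ _ _ tens_pi tens_piZ.

Definition tensor m n : tens := tens_pi (free_pair m n).

Fact tensor_bilinear : bilinear_for *:%R *:%R tensor.
Proof.
split=> [n a m m'|m a n n']; rewrite /tensor -linearP; apply/tens_pi_eq.
- exact: tens_span_l.
- exact: tens_span_r.
Qed.
HB.instance Definition _ :=
  bilinear_isBilinear.Build F M N tens *:%R *:%R tensor tensor_bilinear.

Lemma tensor_sum (t : tens) :
  exists s : seq (M * N), t = \sum_(p <- s) tensor p.1 p.2.
Proof.
set u := repr (t : Quotient.quot tens_zmod_rel).
exists [seq (mcoeff p u *: p.1, p.2) | p <- msupp u].
rewrite big_map -[LHS]tens_pi_repr -/u [u in LHS]monalgE raddf_sum /=.
apply: eq_bigr => -[m n] _ /=; rewrite linearZl_LR /= -linearZ /=.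
congr tens_pi; apply/malgP => k.
by rewrite fgscaleE !mcoeffU mulrnAr mulr1.
Qed.

End Tensor.

Notation "M \ox N" := (tens M N) : type_scope.
Notation "m \ox n" := (tensor m n) : ring_scope.

Section TensorLift.
Variables (F : fieldType) (M N P : lmodType F).

Definition free_lift (b : M -> N -> P) (u : {malg F[(M * N)%type]}) : P :=
  \sum_(p <- msupp u) mcoeff p u *: b p.1 p.2.

Lemma free_liftEw b u (d : {fset M * N}) : (msupp u `<=` d)%fset ->
  free_lift b u = \sum_(p <- d) mcoeff p u *: b p.1 p.2.
Proof.
move=> sud; rewrite /free_lift (big_fset_incl _ sud) // => p _ pNu.
by rewrite mcoeff_outdom // scale0r.
Qed.

Fact free_lift_linear b : linear (free_lift b).
Proof.
move=> a u v; set w := a *: u + v.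
pose d := (msupp w `|` (msupp u `|` msupp v))%fset.
rewrite (@free_liftEw _ w d) ?fsubsetUl //.
rewrite (@free_liftEw _ u d); last first.
  by rewrite /d fsetUCA fsubsetUl.
rewrite (@free_liftEw _ v d); last first.
  by rewrite /d fsetUA fsubsetUr.
rewrite scaler_sumr -big_split /=; apply: eq_bigr => p _.
by rewrite mcoeffD fgscaleE scalerDl scalerA.
Qed.
HB.instance Definition _ b :=
  GRing.isLinear.Build F _ _ _ (free_lift b) (free_lift_linear b).

Lemma free_lift_pair b m n : free_lift b (free_pair m n) = b m n.
Proof.
rewrite (@free_liftEw _ _ [fset (m, n)]%fset) ?msuppU_le //.
by rewrite big_seq_fset1 mcoeffUU scale1r.
Qed.

Lemma free_lift_span (b : {bilinear M -> N -> P}) u :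
  tens_span u -> free_lift b u = 0.
Proof.
elim=> [a m m' n|a m n n'||a {}u v _ u0 _ v0]; last 1 first.
- by rewrite linearP /= u0 v0 scaler0 addr0.
- by rewrite linearB linearP /= !free_lift_pair linearPl subrr.
- by rewrite linearB linearP /= !free_lift_pair linearPr subrr.
- exact: linear0.
Qed.

Definition tens_lift (b : {bilinear M -> N -> P}) (t : M \ox N) : P :=
  free_lift b (repr (t : Quotient.quot (tens_zmod_rel M N))).

Lemma tens_lift_pi (b : {bilinear M -> N -> P}) u :
  tens_lift b (tens_pi u) = free_lift b u.
Proof.
apply/eqP; rewrite -subr_eq0 -linearB; apply/eqP/free_lift_span.
by apply/tens_pi_eq; rewrite tens_pi_repr.
Qed.

Lemma tens_liftE (b : {bilinear M -> N -> P}) m n :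
  tens_lift b (m \ox n) = b m n.
Proof. by rewrite tens_lift_pi free_lift_pair. Qed.

Fact tens_lift_linear (b : {bilinear M -> N -> P}) : linear (tens_lift b).
Proof.
move=> a s t; rewrite -[s]tens_pi_repr -[t]tens_pi_repr.
by rewrite -linearP !tens_lift_pi linearP.
Qed.
HB.instance Definition _ (b : {bilinear M -> N -> P}) :=
  GRing.isLinear.Build F _ _ _ (tens_lift b) (tens_lift_linear b).

Lemma tens_ext (f g : {linear (M \ox N)%type -> P}) :
  (forall m n, f (m \ox n) = g (m \ox n)) -> f =1 g.
Proof.
move=> fg t; have [s ->] := tensor_sum t.
by rewrite !linear_sum; apply: eq_bigr => p _; exact: fg.
Qed.

End TensorLift.

HB.mixin Record isLeftLeibniz (F : fieldType) L of GRing.Lmodule F L := {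
  leibmul : L -> L -> L;
  leibmul_bilinear : bilinear_for *:%R *:%R leibmul;
  leibmulA : forall x y z,
    leibmul x (leibmul y z) = leibmul (leibmul x y) z + leibmul y (leibmul x z)
}.

#[short(type="leftLeibnizType")]
HB.structure Definition LeftLeibniz (F : fieldType) :=
  {L of GRing.Lmodule F L & isLeftLeibniz F L}.

Notation "x \** y" := (leibmul x y) : ring_scope.

HB.instance Definition _ (F : fieldType) (L : leftLeibnizType F) :=
  bilinear_isBilinear.Build F L L L *:%R *:%R (@leibmul F L)
    (@leibmul_bilinear F L).

(* A vector space with bilinear left and right actions, no compatibility
   between the actions and the product of L being required. *)
HB.mixin Record hasBiaction (F : fieldType) (L : leftLeibnizType F) M
    of GRing.Lmodule F M := {
  lact : L -> M -> M;
  ract : M -> L -> M;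
  lact_bilinear : bilinear_for *:%R *:%R lact;
  ract_bilinear : bilinear_for *:%R *:%R ract
}.

#[short(type="biactionType")]
HB.structure Definition Biaction (F : fieldType) (L : leftLeibnizType F) :=
  {M of GRing.Lmodule F M & hasBiaction F L M}.

Notation "x \*> m" := (lact x m) : ring_scope.
Notation "m \<* x" := (ract m x) : ring_scope.

HB.instance Definition _ (F : fieldType) (L : leftLeibnizType F)
    (M : biactionType L) :=
  bilinear_isBilinear.Build F L M M *:%R *:%R (@lact F L M)
    (@lact_bilinear F L M).
HB.instance Definition _ (F : fieldType) (L : leftLeibnizType F)
    (M : biactionType L) :=
  bilinear_isBilinear.Build F M L M *:%R *:%R (@ract F L M)
    (@ract_bilinear F L M).

Section Bimodule.
Variables (F : fieldType) (L : leftLeibnizType F) (M : biactionType L).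

Definition LLM : Prop := forall (x y : L) (m : M),
  (x \** y) \*> m = x \*> (y \*> m) - y \*> (x \*> m).

Definition LML : Prop := forall (x y : L) (m : M),
  (x \*> m) \<* y = x \*> (m \<* y) - m \<* (x \** y).

Definition MLL : Prop := forall (x y : L) (m : M),
  (m \<* x) \<* y = m \<* (x \** y) - x \*> (m \<* y).

Definition bimodule : Prop := [/\ LLM, LML & MLL].

Definition symmetric_biaction : Prop :=
  forall (x : L) (m : M), m \<* x = - (x \*> m).

Definition antisymmetric_biaction : Prop :=
  forall (x : L) (m : M), m \<* x = 0.

End Bimodule.

Arguments LLM {F L} M%_type.
Arguments LML {F L} M%_type.
Arguments MLL {F L} M%_type.
Arguments bimodule {F L} M%_type.
Arguments symmetric_biaction {F L} M%_type.
Arguments antisymmetric_biaction {F L} M%_type.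

Section TensorBiaction.
Variables (F : fieldType) (L : leftLeibnizType F) (M N : biactionType L).

Definition lact_pure (x : L) (m : M) (n : N) : M \ox N :=
  (x \*> m) \ox n + m \ox (x \*> n).

Definition ract_pure (x : L) (m : M) (n : N) : M \ox N :=
  (m \<* x) \ox n + m \ox (n \<* x).

Fact lact_pure_bilinear x : bilinear_for *:%R *:%R (lact_pure x).
Proof.
split=> [n a m m'|m a n n'] /=; rewrite /lact_pure.
- by rewrite linearPr !linearPl scalerDr addrACA.
- by rewrite !linearPr scalerDr addrACA.
Qed.
HB.instance Definition _ x :=
  bilinear_isBilinear.Build F M N (M \ox N)%type *:%R *:%R (lact_pure x)
    (lact_pure_bilinear x).

Fact ract_pure_bilinear x : bilinear_for *:%R *:%R (ract_pure x).
Proof.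
split=> [n a m m'|m a n n'] /=; rewrite /ract_pure.
- by rewrite !linearPl scalerDr addrACA.
- by rewrite linearPl !linearPr scalerDr addrACA.
Qed.
HB.instance Definition _ x :=
  bilinear_isBilinear.Build F M N (M \ox N)%type *:%R *:%R (ract_pure x)
    (ract_pure_bilinear x).

Definition tens_lact (x : L) (t : M \ox N) : M \ox N :=
  tens_lift (lact_pure x) t.

Definition tens_ract (t : M \ox N) (x : L) : M \ox N :=
  tens_lift (ract_pure x) t.

Fact tens_lact_bilinear : bilinear_for *:%R *:%R tens_lact.
Proof.
split=> [t a x y|x a s t]; last by rewrite /tens_lact linearP.
have [s ->] := tensor_sum t.
rewrite /tens_lact !linear_sum /= scaler_sumr -big_split /=.
apply: eq_bigr => p _; rewrite !tens_liftE /= /lact_pure.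
by rewrite !linearPl linearPr scalerDr addrACA.
Qed.

Fact tens_ract_bilinear : bilinear_for *:%R *:%R tens_ract.
Proof.
split=> [x a s t|t a x y]; first by rewrite /tens_ract linearP.
have [s ->] := tensor_sum t.
rewrite /tens_ract !linear_sum /= scaler_sumr -big_split /=.
apply: eq_bigr => p _; rewrite !tens_liftE /= /ract_pure.
by rewrite linearPr linearPl !linearPr scalerDr addrACA.
Qed.

HB.instance Definition _ := hasBiaction.Build F L (M \ox N)%type
  tens_lact_bilinear tens_ract_bilinear.

Lemma lact_tensor (x : L) (m : M) (n : N) :
  x \*> (m \ox n) = (x \*> m) \ox n + m \ox (x \*> n).
Proof. exact: tens_liftE. Qed.

Lemma ract_tensor (x : L) (m : M) (n : N) :
  (m \ox n) \<* x = (m \<* x) \ox n + m \ox (n \<* x).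
Proof. exact: tens_liftE. Qed.

End TensorBiaction.

(* Main.v *)
(* All the conditions are additive in the tensor, so they may be tested on pure
   tensors.  There (LLM) and (LML) follow by expanding both sides: the mixed
   terms cancel.  For (MLL) the mixed terms do not cancel, and the difference
   between the two sides is exactly
   (x m + m x) \ox (n y) + (m y) \ox (x n + n x). *)
Require Import Defs.
From HB Require Import structures.
From mathcomp Require Import all_boot all_order all_algebra.

Set Implicit Arguments.
Unset Strict Implicit.
Unset Printing Implicit Defensive.

Import GRing.Theory.
Local Open Scope ring_scope.

Section BilinearOperations.
Variables (F : fieldType) (L : leftLeibnizType F) (M : biactionType L).
Variables (U V : lmodType F).

Lemma lactDr (x : L) (m m' : M) : x \*> (m + m') = x \*> m + x \*> m'.
Proof. exact: linearDr. Qed.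

Lemma ractDl (x : L) (m m' : M) : (m + m') \<* x = m \<* x + m' \<* x.
Proof. exact: linearDl. Qed.

Lemma tensorDl (u u' : U) (v : V) : (u + u') \ox v = u \ox v + u' \ox v.
Proof. exact: linearDl. Qed.

Lemma tensorDr (u : U) (v v' : V) : u \ox (v + v') = u \ox v + u \ox v'.
Proof. exact: linearDr. Qed.

Lemma tensorNl (u : U) (v : V) : (- u) \ox v = - (u \ox v).
Proof. exact: linearNl. Qed.

Lemma tensorNr (u : U) (v : V) : u \ox (- v) = - (u \ox v).
Proof. exact: linearNr. Qed.

Lemma tensor0l (v : V) : (0 : U) \ox v = 0.
Proof. exact: linear0l. Qed.

Lemma tensor0r (u : U) : u \ox (0 : V) = 0.
Proof. exact: linear0r. Qed.

End BilinearOperations.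

(** Closure under scaling is not asked for: [tensor_sum] absorbs the coefficients into the left
    factors, so sums of pure tensors exhaust the space. *)
Lemma tens_ind (F : fieldType) (M N : lmodType F) (P : M \ox N -> Prop) :
  (forall m n, P (m \ox n)) -> (forall s t, P s -> P t -> P (s + t)) ->
  forall t, P t.
Proof.
move=> Ppure PD t; have [s ->] := tensor_sum t.
elim: s => [|p s IHs]; last by rewrite big_cons; apply: PD.
(* The empty sum is itself pure, being 0 tensor 0. *)
by rewrite big_nil -(tensor0l M (0 : N)).
Qed.

Section TensorBimodule.
Variables (F : fieldType) (L : leftLeibnizType F) (M N : biactionType L).
Implicit Types (x y : L) (m : M) (n : N).

(** The mixed terms of the iterated left action are symmetric under exchanging [x] and [y], so they
    vanish in the commutator. *)
Lemma tens_LLM : LLM M -> LLM N -> LLM (M \ox N).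
Proof.
move=> hM hN x y; elim/tens_ind => [m n|s t hs ht]; last first.
  by rewrite !lactDr hs ht opprD addrACA.
(* Solved for this term, and with the subtracted term of the goal moved across, everything becomes a
   sum without signs; only a permutation of summands remains. *)
have {}hM : x \*> (y \*> m) = (x \** y) \*> m + y \*> (x \*> m).
  by rewrite hM subrK.
have {}hN : x \*> (y \*> n) = (x \** y) \*> n + y \*> (x \*> n).
  by rewrite hN subrK.
apply/eqP; rewrite eq_sym subr_eq !lact_tensor !lactDr !lact_tensor.
rewrite hM hN tensorDl tensorDr; apply/eqP.
by rewrite [LHS](AC ((2*1)*(1*2)) ((1*5)*((2*4)*(3*6)))).
Qed.

(** Acting by [x] on the left and by [y] on the right yields the same two mixed terms in either
    order. *)
Lemma tens_LML : LML M -> LML N -> LML (M \ox N).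
Proof.
move=> hM hN x y; elim/tens_ind => [m n|s t hs ht]; last first.
  by rewrite lactDr !ractDl lactDr hs ht opprD addrACA.
have {}hM : x \*> (m \<* y) = (x \*> m) \<* y + m \<* (x \** y).
  by rewrite hM subrK.
have {}hN : x \*> (n \<* y) = (x \*> n) \<* y + n \<* (x \** y).
  by rewrite hN subrK.
apply/eqP; rewrite eq_sym subr_eq !(lact_tensor, ract_tensor).
rewrite lactDr ractDl !(lact_tensor, ract_tensor).
rewrite hM hN tensorDl tensorDr; apply/eqP.
by rewrite [LHS](AC ((2*1)*(1*2)) (((1*4)*(3*5))*(2*6))).
Qed.

(** Two right actions give mixed terms with [m \<* x] and [n \<* x]; the subtracted left action
    gives those with [x \*> m] and [x \*> n]. Moved to one side they add up. *)
Lemma tens_MLL_defect x y m n : MLL M -> MLL N ->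
  ((m \ox n) \<* x) \<* y =
  (m \ox n) \<* (x \** y) - x \*> ((m \ox n) \<* y) +
  ((x \*> m + m \<* x) \ox (n \<* y) + (m \<* y) \ox (x \*> n + n \<* x)).
Proof.
move=> hM hN.
have {}hM : m \<* (x \** y) = (m \<* x) \<* y + x \*> (m \<* y).
  by rewrite hM subrK.
have {}hN : n \<* (x \** y) = (n \<* x) \<* y + x \*> (n \<* y).
  by rewrite hN subrK.
apply/eqP; rewrite addrAC eq_sym subr_eq !ract_tensor.
rewrite lactDr ractDl !(lact_tensor, ract_tensor).
rewrite hM hN !tensorDl !tensorDr; apply/eqP.
by rewrite [LHS](AC ((2*2)*(2*2)) (((1*6)*(8*3))*((2*7)*(5*4)))).
Qed.

Lemma tens_MLLP : MLL M -> MLL N ->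
  MLL (M \ox N) <->
  (forall x y m n, (x \*> m + m \<* x) \ox (n \<* y) +
                   (m \<* y) \ox (x \*> n + n \<* x) = 0).
Proof.
move=> hM hN; split=> [h x y m n|h x y].
  have := tens_MLL_defect x y m n hM hN; rewrite h => /eqP.
  (* The equation has the form A = A + D, with D the defect; subtracting leaves - D = 0. *)
  by rewrite -subr_eq0 opprD addrA subrr add0r oppr_eq0 => /eqP.
elim/tens_ind => [m n|s t hs ht]; first by rewrite tens_MLL_defect // h addr0.
by rewrite !ractDl lactDr hs ht opprD addrACA.
Qed.

Lemma tens_symmetric : symmetric_biaction M -> symmetric_biaction N ->
  symmetric_biaction (M \ox N).
Proof.
move=> sM sN x; elim/tens_ind => [m n|s t hs ht].
  by rewrite ract_tensor lact_tensor sM sN tensorNl tensorNr opprD.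
by rewrite ractDl lactDr hs ht opprD.
Qed.

Lemma tens_antisymmetric :
  antisymmetric_biaction M -> antisymmetric_biaction N ->
  antisymmetric_biaction (M \ox N).
Proof.
move=> aM aN x; elim/tens_ind => [m n|s t hs ht].
  by rewrite ract_tensor aM aN tensor0l tensor0r addr0.
by rewrite ractDl hs ht addr0.
Qed.

End TensorBimodule.

Theorem proposition3p1 (F : fieldType) (L : leftLeibnizType F)
    (M N : biactionType L) (hM : bimodule M) (hN : bimodule N) :
  [/\ LLM (M \ox N),
      LML (M \ox N),
      MLL (M \ox N) <->
        (forall (x y : L) (m : M) (n : N),
           (x \*> m + m \<* x) \ox (n \<* y) +
           (m \<* y) \ox (x \*> n + n \<* x) = 0),
      (symmetric_biaction M -> symmetric_biaction N ->
         bimodule (M \ox N) /\ symmetric_biaction (M \ox N)) &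
      (antisymmetric_biaction M -> antisymmetric_biaction N ->
         bimodule (M \ox N) /\ antisymmetric_biaction (M \ox N))].
Proof.
case: hM hN => [llM lmM mlM] [llN lmN mlN].
have ll := tens_LLM llM llN; have lm := tens_LML lmM lmN.
have ml := tens_MLLP mlM mlN.
split; [exact: ll | exact: lm | exact: ml | move=> sM sN | move=> aM aN].
  split; last exact: tens_symmetric.
  split; [exact: ll | exact: lm | apply/ml => x y m n].
  (* Symmetry kills the factors that add the two actions of [x]. The argument of [sN x] keeps
     [n \<* y] from being rewritten instead. *)
  by rewrite sM (sN x) !subrr tensor0l tensor0r addr0.
split; last exact: tens_antisymmetric.
split; [exact: ll | exact: lm | apply/ml => x y m n].
(* Here the other factors vanish, the right actions of [y]. *)
by rewrite (aN y) (aM y) tensor0l tensor0r addr0.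
Qed.
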